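(* Let $q\ge 2$ and $0\le r<q$ be fixed integers. For each large integer $n$ let $k=k(n,q)>0$ be the greatest integer such that $\binom{n}{k}q^{-k}\ge 1$. Then with high probability $|f(G_{n,1/2},r,q)-k|=O(\log^{10}n)$; that is, there is a constant $C=C(q,r)>0$ such that $$\lim_{n\to\infty}\mathbb P\big[\,|f(G_{n,1/2},r,q)-k(n,q)|\le C\log^{10}n\,\big]=1.$$
   Context: $G_{n,1/2}$ is the random graph on $n$ labelled vertices in which each unordered pair of distinct vertices is included as an edge independently with probability $1/2$. For a finite simple graph $G$ and integers $r\ge 0$, $q\ge 2$, $f(G,r,q)$ denotes the maximum number of vertices of an induced subgraph of $G$ in which every vertex has degree (within the induced subgraph) congruent to $r \pmod q$; set $f(G,r,q)=0$ if no such subgraph exists. ''With high probability'' means with probability tending to $1$ as $n\to\infty$, with $q,r$ fixed. *)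

(* Defs.v *)
From mathcomp Require Import all_boot all_order all_algebra.
From mathcomp Require Import all_classical all_reals all_analysis.

Set Implicit Arguments.
Unset Strict Implicit.
Unset Printing Implicit Defensive.

Import Order.TTheory GRing.Theory Num.Theory.
Import numFieldNormedType.Exports.

Local Open Scope ring_scope.

Definition vertex_pairs (T : finType) : {set {set T}} :=
  [set e : {set T} | #|e| == 2%N].

(* A finite simple graph on T is given by its edge set. *)
Definition sgraph (T : finType) : finType :=
  {E : {set {set T}} | E \subset vertex_pairs T}.

Definition edges (T : finType) (G : sgraph T) : {set {set T}} := val G.

(* Irreflexive because [set x; x] is a singleton. *)
Definition adj (T : finType) (G : sgraph T) : rel T :=
  fun x y => [set x; y] \in edges G.

(* Degree of x in the subgraph of G induced by S. *)
Definition induced_degree (T : finType) (G : sgraph T) (S : {set T}) (x : T)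
    : nat := #|[set y in S | adj G x y]|.

Definition induces_mod (T : finType) (G : sgraph T) (r q : nat) (S : {set T})
    : bool := [forall x in S, induced_degree G S x == r %[mod q]].

(* The parameter f(G, r, q).  The maximum over an empty family is 0; the empty
   set always qualifies, so it does not affect the value. *)
Definition max_induced_mod (T : finType) (G : sgraph T) (r q : nat) : nat :=
  \max_(S : {set T} | induces_mod G r q S) #|S|.

(* Probability of the event A under the law of G_{n,p}, the independent
   Bernoulli(p) product over the unordered pairs of distinct vertices. *)
Definition gnp_weight (R : realType) (p : R) (n : nat) (G : sgraph 'I_n) : R :=
  \prod_(e in vertex_pairs 'I_n) (if e \in edges G then p else 1 - p).

Definition gnp_prob (R : realType) (p : R) (n : nat) (A : pred (sgraph 'I_n))
    : R := \sum_(G : sgraph 'I_n | A G) gnp_weight p G.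

(* k(n, q).  Indices above n need not be searched, since 'C(n, k) = 0 there;
   see kmod_spec. *)
Definition kmod (n q : nat) : nat :=
  \max_(k < n.+1 | 1 <= 'C(n, k)%:R * (q%:R : rat) ^- k) k.

Lemma kmod_spec (n q : nat) : (0 < q <= n)%N ->
  [/\ (0 < kmod n q)%N,
      1 <= 'C(n, kmod n q)%:R * (q%:R : rat) ^- kmod n q
    & forall j : nat, 1 <= 'C(n, j)%:R * (q%:R : rat) ^- j ->
      (j <= kmod n q)%N].
Proof.
case/andP=> q0 qn.
have le_kmod j : 1 <= 'C(n, j)%:R * (q%:R : rat) ^- j -> (j <= kmod n q)%N.
  case: (ltnP n j) => [nj|jn]; first by rewrite bin_small // mul0r ler10.
  move=> H; have jn1 : (j < n.+1)%N by [].
  exact: (bigop.bigmax_sup (Ordinal jn1)).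
have one : 1 <= 'C(n, 1)%:R * (q%:R : rat) ^- 1.
  by rewrite bin1 expr1 ler_pdivlMr ?ltr0n // mul1r ler_nat.
split=> //; first exact: le_kmod.
have H0 : 1 <= ('C(n, (ord0 : 'I_n.+1)))%:R * (q%:R : rat) ^- (ord0 : 'I_n.+1).
  by rewrite bin0 expr0 invr1 mulr1.
by rewrite /kmod (bigop.bigmax_eq_arg ord0) //; case: arg_maxnP.
Qed.

(* Main.v *)
(*
Call a vertex set S good if it induces degrees congruent to r mod q.  The mean
number of good k-sets is about C(n,k) q^-k, up to a bounded factor, and this
changes geometrically near k(n,q), because k(n,q) >= n/q makes the ratio of
consecutive terms at most 1 - 1/(2q).  So the first moment rules out good sets
larger than k(n,q) + log^4 n, and the second moment produces one of some even
size k' with k(n,q) - k' about log^4 n.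

For the second moment, let S, U be k'-sets with B = S \cap U, and condition on
all pairs except those inside S but not inside B; the goodness of U is then
decided.  Expanding the goodness of S in characters x : S -> Z/q, a pair uv
contributes |1 + w^(x u + x v)|, which is 2 if x u + x v = 0 and at most
2 tau^2 < 2 otherwise.  Let c be the most popular value of x on S \ B; each
vertex with x v <> -c lies in many pairs with nonzero sum, so only the
characters with x = -c throughout S, which forces 2c = 0, contribute as soon as
|S \ B| >= log^2 n.  The pairs (S, U) with |S \ U| < q log^2 n are too few to
matter, since the mean exceeds exp(c log^4 n).
*)
Require Import Defs.
From mathcomp Require Import all_boot all_order all_algebra all_field.
From mathcomp Require Import zify ring lra.

Set Implicit Arguments.
Unset Strict Implicit.
Unset Printing Implicit Defensive.

Import Order.TTheory GRing.Theory Num.Theory.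

Local Open Scope ring_scope.

(** * Degree residues and characters *)

Lemma sum_prim_root (C : numClosedFieldType) (q : nat) (w : C) (m : nat) :
  q.-primitive_root w ->
  \sum_(j < q) w ^+ (j * m) = if (q %| m)%N then q%:R else 0.
Proof.
move=> wq; under eq_bigr do rewrite mulnC exprM.
case: ifP => [|/negbT]; rewrite (prim_order_dvd wq).
  move=> /eqP ->; under eq_bigr do rewrite expr1n.
  by rewrite sumr_const card_ord.
move=> wm; have := subrX1 (w ^+ m) q.
rewrite -exprM mulnC exprM (prim_expr_order wq) expr1n subrr => /esym/eqP.
by rewrite mulf_eq0 subr_eq0 (negPf wm) => /eqP.
Qed.

Lemma sum_subsets_prod (R : comNzRingType) (I : finType) (H : {set I})
    (z : I -> R) :
  \sum_(F : {set I} | F \subset H) \prod_(e in F) z e =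
  \prod_(e in H) (1 + z e).
Proof.
have -> : \prod_(e in H) (1 + z e) =
    \prod_e ((if e \in H then z e else 0) + 1).
  by rewrite big_mkcond; apply: eq_bigr => e _; case: ifP => _; rewrite addrC ?addr0.
rewrite bigA_distr [RHS](bigID (fun F : {set I} => F \subset H)) /=.
rewrite [X in _ = _ + X]big1 ?addr0 => [|F /subsetPn [e eF eH]]; last first.
  by rewrite (bigD1 e) //= eF (negPf eH) mul0r.
apply: eq_bigr => F FH; rewrite big_mkcond /=; apply: eq_bigr => e _.
by case: ifP => // eF; rewrite (subsetP FH).
Qed.

(* Bounds the sum over c in Z/q and x : S -> Z/q, x not constantly -c, of
   s^t to the number of v in S with x v <> -c. *)
Definition fourier_error (F : numDomainType) (p : nat) (s : F) (k t : nat) : F :=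
  p.+1%:R * ((1 + p%:R * s ^+ t) ^+ k - 1).

(* Equal to 1 for odd q and to 2 for even q. *)
Definition self_opposite (q : nat) : nat := #|[pred c : 'I_q | (q %| c + c)%N]|.

Section Fourier.
Variables (C : numClosedFieldType) (T : finType) (p : nat) (w : C).
Let q := p.+1.
Hypothesis wq : q.-primitive_root w.

(** [H] holds the pairs still to be exposed, and [d v] carries the degree of [v] already decided
    together with the shift by [-r]. *)
Definition residue_sets (S : {set T}) (H : {set {set T}}) (d : T -> nat) :=
  [set F : {set {set T}} | (F \subset H) &&
     [forall v in S, (q %| d v + #|[set e in F | v \in e]|)%N]].

Definition fourier_term (S : {set T}) (H : {set {set T}}) (d : T -> nat)
    (x : {ffun T -> 'I_q}) : C :=
  \prod_(v in S) w ^+ (x v * d v) * \prod_(e in H) (1 + w ^+ (\sum_(v in e) x v)).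

(** Orthogonality at each vertex of [S] turns the congruence into a sum over Z/q. Multiplying out
    gives a sum over characters [x], and for fixed [x] the sum over edge sets factors over the pairs
    of [H]. *)
Lemma residue_sets_fourier (S : {set T}) (H : {set {set T}}) (d : T -> nat) :
    {in H, forall e : {set T}, e \subset S} ->
  q%:R ^+ #|S| * #|residue_sets S H d|%:R =
  \sum_(x in pffun_on ord0 (mem S) predT) fourier_term S H d x.
Proof.
move=> HS.
have -> : q%:R ^+ #|S| * #|residue_sets S H d|%:R =
    \sum_(F : {set {set T}} | F \subset H)
      \prod_(v in S) \sum_(j < q) w ^+ (j * (d v + #|[set e in F | v \in e]|)).
  rewrite -(sum1_card (mem (residue_sets S H d))) natr_sum mulr_sumr big_mkcond
    [RHS]big_mkcond /=.
  apply: eq_bigr => F _; rewrite inE; case: (F \subset H) => //=.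
  under [RHS]eq_bigr do rewrite (sum_prim_root _ wq).
  case: ifP => [/forall_inP h | /negbT].
    under [RHS]eq_bigr => v vS do rewrite (h v vS).
    by rewrite prodr_const mulr1.
  rewrite negb_forall_in => /exists_inP [v vS h].
  by rewrite (bigD1 v) //= (negPf h) mul0r.
under eq_bigr do rewrite (big_distr_big ord0) /=.
rewrite exchange_big /=; apply: eq_bigr => x _.
under eq_bigr => F FH.
  rewrite (_ : \prod_(_ in _) _ = \prod_(v in S) w ^+ (x v * d v) *
     \prod_(e in F) w ^+ (\sum_(v in e) x v)); last first.
    rewrite !prodrXr -exprD; congr (_ ^+ _).
    under eq_bigr do rewrite mulnDr.
    rewrite big_split; congr (_ + _)%N => /=.
    (* Double counting of the incidences between vertices of [S] and pairs of [F]; as each pair lies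
       inside [S], it collects [x v] from all its vertices. *)
    under eq_bigr do rewrite -sum1_card big_distrr /=.
    under [RHS]eq_bigr => e eF.
      rewrite (_ : (\sum_(_ in _) _)%N =
        \sum_(v in S) if v \in e then x v : nat else 0)%N; last first.
      rewrite -big_mkcondr; apply: eq_bigl => v.
      case ve: (v \in e); rewrite ?andbT ?andbF //.
      by rewrite (subsetP (HS e (subsetP FH _ eF))).
    over.
    rewrite exchange_big /=; apply: eq_bigr => v _.
    rewrite -big_mkcondr; apply: eq_big => [e|e]; by rewrite ?inE ?muln1.
over.
by rewrite -mulr_sumr sum_subsets_prod.
Qed.

Lemma prim_root_norm1 (m : nat) : `|w ^+ m| = 1.
Proof.
apply/eqP; rewrite -(@pexpr_eq1 _ `|w ^+ m| q) // -normrX -exprM mulnC exprM.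
by rewrite (prim_expr_order wq) expr1n normr1.
Qed.

(** Equality in the triangle inequality would make 1 and [w ^+ m] parallel unit vectors, hence
    equal. *)
Lemma norm_add1_lt2 (m : nat) : ~~ (q %| m)%N -> `|1 + w ^+ m| < 2.
Proof.
move=> qm; rewrite lt_neqAle; apply/andP; split; last first.
  by rewrite (le_trans (ler_normD _ _)) // normr1 prim_root_norm1 -mulr2n.
apply: contra qm => /eqP h; rewrite (prim_order_dvd wq).
have : `|1 + w ^+ m| = `|1| + `|w ^+ m| by rewrite h normr1 prim_root_norm1 -mulr2n.
by case/normCDeq => t _; rewrite prim_root_norm1 normr1 mul1r => -[<- <-].
Qed.

(* The characters x with x u + x v = 0 for all u, v in S, extended by 0 off S. *)
Definition main_chars (S : {set T}) : {set {ffun T -> 'I_q}} :=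
  [set [ffun v => if v \in S then c else ord0] | c in [pred c : 'I_q | (q %| c + c)%N]].

Lemma card_main_chars_le (S : {set T}) :
  (#|main_chars S| <= self_opposite q)%N.
Proof. exact: leq_imset_card. Qed.

Lemma card_main_chars (S : {set T}) : S != set0 ->
  #|main_chars S| = self_opposite q.
Proof.
rewrite /self_opposite; case/set0Pn => v vS; apply: card_imset => c c' /ffunP /(_ v).
by rewrite !ffunE vS.
Qed.

Lemma main_charsP (S : {set T}) (x : {ffun T -> 'I_q}) (c : 'I_q) :
  x \in pffun_on ord0 (mem S) predT -> (q %| c + c)%N ->
  {in S, forall v, q %| x v + c}%N -> x \in main_chars S.
Proof.
move=> /pffun_onP [xS _] qc xc; apply/imsetP; exists c => //.
apply/ffunP => v; rewrite ffunE; case: ifP => [vS|/negP vS].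
  apply: val_inj => /=; rewrite -[LHS](@modn_small _ q) // -[RHS](@modn_small _ q) //.
  by apply/eqP; rewrite -(eqn_modDr c) (eqP (xc v vS)) (eqP qc).
by apply/eqP/negPn/negP => xv; apply: vS; apply: (subsetP xS).
Qed.

Lemma pigeonhole_color (A : {set T}) (x : T -> 'I_q) (t : nat) :
  (q * t < #|A|)%N -> exists c, (t < #|[set v in A | x v == c]|)%N.
Proof.
move=> At; apply/existsP; apply: contraLR At; rewrite negb_exists -leqNgt => /forallP h.
rewrite -sum1_card (partition_big x predT) //=.
apply: (@leq_trans (\sum_(c < q) t)%N); last by rewrite sum_nat_const card_ord.
by apply: leq_sum => c _; rewrite leqNgt sum1dep_card; apply: contra (h c).
Qed.

(* The pairs of vertices of S that are not contained in B. *)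
Definition touching (S B : {set T}) : {set {set T}} :=
  [set e : {set T} | [&& #|e| == 2, e \subset S & ~~ (e \subset B)]].

Definition bad_pairs (S B : {set T}) (x : T -> 'I_q) : {set {set T}} :=
  [set e in touching S B | ~~ (q %| \sum_(v in e) x v)%N].

Definition off_class (S : {set T}) (x : T -> 'I_q) (c : 'I_q) : {set T} :=
  [set v in S | ~~ (q %| x v + c)%N].

Lemma set2_injr (u v v' : T) : v != u -> [set u; v] = [set u; v'] -> v = v'.
Proof.
move=> vu e; have: v \in [set u; v'] by rewrite -e !inE eqxx orbT.
by rewrite !inE (negPf vu) /= => /eqP.
Qed.

Lemma sum_set2 (u v : T) (x : T -> nat) : u != v ->
  (\sum_(y in [set u; v]) x y = x u + x v)%N.
Proof. by move=> uv; rewrite big_setU1 ?big_set1 // inE. Qed.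

Lemma bad_pairs_ge (S B : {set T}) (x : T -> 'I_q) (c : 'I_q) (t : nat) :
  (t < #|[set v in S :\: B | x v == c]|)%N ->
  (#|off_class S x c| * t <= 2 * #|bad_pairs S B x|)%N.
Proof.
set M := [set v in S :\: B | x v == c] => tM.
(* Every u with x u <> -c forms a bad pair with each v in M other than u. *)
have -> : (2 * #|bad_pairs S B x| =
  \sum_(v : T) #|[set e in bad_pairs S B x | v \in e]|)%N.
  rewrite mulnC -sum_nat_const; under [RHS]eq_bigr do rewrite -sum1_card.
  under [RHS]eq_bigr => v _ do under eq_bigl do rewrite inE.
  rewrite (exchange_big_dep (mem (bad_pairs S B x))) /=; last by move=> ? ? _ /andP [].
  apply: eq_bigr => e eb; under eq_bigl do rewrite eb.
  by rewrite sum1_card; move: eb; rewrite !inE -andbA => /andP [/eqP ->].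
rewrite (bigID (mem (off_class S x c))) /=; apply: leq_trans (leq_addr _ _).
rewrite -sum_nat_const.
apply: leq_sum => u uW.
(* The vertex [u] may itself lie in [M]; the strict bound [t < #|M|] still leaves [t] partners. *)
have : (t <= #|M :\ u|)%N.
  by move: tM; rewrite (cardsD1 u M); case: (u \in M) => //=; lia.
move=> /leq_trans; apply.
rewrite -(card_in_imset (f := fun v => [set u; v]) (D := M :\ u)); last first.
  by move=> v v'; rewrite !inE => /andP [vu _] _; apply: set2_injr.
apply: subset_leq_card; apply/subsetP => e /imsetP [v]; rewrite !inE.
move=> /and3P [vu /andP [vB vS] /eqP xv] ->; rewrite set21 andbT.
move: uW; rewrite inE => /andP [uS uc].
have uv : u != v by rewrite eq_sym.
rewrite sum_set2 //= xv uc andbT cards2 uv /=.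
by rewrite !subUset !sub1set uS vS (negPf vB) andbF.
Qed.

Variable tau : C.
Hypothesis tau01 : 0 <= tau <= 1.
(* The square absorbs the factor 2 in bad_pairs_ge. *)
Hypothesis tauP : forall m, ~~ (q %| m)%N -> `|1 + w ^+ m| <= 2 * tau ^+ 2.

Lemma norm_fourier_term (S B : {set T}) (d : T -> nat) (x : {ffun T -> 'I_q}) :
  `|fourier_term S (touching S B) d x| <=
  2 ^+ #|touching S B| * tau ^+ (2 * #|bad_pairs S B x|).
Proof.
rewrite normrM normr_prod big1 ?mul1r => [|v _]; last exact: prim_root_norm1.
rewrite normr_prod (bigID (mem (bad_pairs S B x))) /=.
rewrite -(cardsID (bad_pairs S B x) (touching S B)) exprD exprM.
have -> : touching S B :&: bad_pairs S B x = bad_pairs S B x.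
  by apply/setIidPr/subsetP => e; rewrite inE => /andP [].
rewrite mulrAC -exprMn; apply: ler_pM; rewrite ?prodr_ge0 //.
  rewrite (eq_bigl (fun e => e \in bad_pairs S B x)); last first.
    by move=> e; rewrite !inE; case: (_ %| _)%N; rewrite ?andbF ?andbT ?andbb.
  rewrite -prodr_const; apply: ler_prod => e; rewrite inE => /andP [_ eb].
  by rewrite normr_ge0 tauP.
rewrite (eq_bigl (fun e => e \in touching S B :\: bad_pairs S B x)); last first.
  by move=> e; rewrite in_setD andbC.
rewrite -prodr_const; apply: ler_prod => e _; rewrite normr_ge0.
by rewrite (le_trans (ler_normD _ _)) // normr1 prim_root_norm1 -mulr2n.
Qed.

Lemma tau_le_expr (i j : nat) : (i <= j)%N -> tau ^+ j <= tau ^+ i.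
Proof. by case/andP: tau01 => t0 t1; apply: ler_wiXn2l. Qed.

(** The popular value [c] depends on [x]. Summing over every [c] with nonempty [off_class] removes
    this dependence at the cost of a factor [q]. *)
Lemma norm_fourier_term_minor (S B : {set T}) (d : T -> nat) (t : nat)
    (x : {ffun T -> 'I_q}) :
  (q * t < #|S :\: B|)%N -> x \in pffun_on ord0 (mem S) predT ->
  x \notin main_chars S ->
  `|fourier_term S (touching S B) d x| <= 2 ^+ #|touching S B| *
    \sum_(c < q | off_class S x c != set0) (tau ^+ t) ^+ #|off_class S x c|.
Proof.
have [t0 _] := andP tau01.
move=> /pigeonhole_color h xS xM; have [c tc] := h x.
apply: le_trans (norm_fourier_term S B d x) _.
apply: ler_wpM2l; first exact: exprn_ge0.
(* If [off_class S x c] were empty, [x] would be [-c] on all of [S]; as the value [c] is attained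
   there, [2c = 0] and [x] would be a main character. *)
rewrite (bigD1 c) /=; last first.
  apply: contra xM => /eqP off0.
  have xc v : v \in S -> (q %| x v + c)%N.
    by move=> vS; have /setP /(_ v) := off0; rewrite !inE vS /= => /negPn.
  apply: (main_charsP xS _ xc); have : (0 < #|[set v in S :\: B | x v == c]|)%N by lia.
  move=> /card_gt0P [v]; rewrite !inE => /andP [/andP [_ vS] /eqP xv].
  by have := xc v vS; rewrite xv.
rewrite ler_wpDr ?sumr_ge0 // => [i _|]; first by rewrite !exprn_ge0.
by rewrite -exprM tau_le_expr // mulnC bad_pairs_ge.
Qed.

(** The weight factors over the vertices of [S]: the value [-c] has weight 1 and the other [p]
    values have weight [s]. The subtracted 1 is the term of the character constantly [-c] on [S]. *)
Lemma sum_off_class (S : {set T}) (c : 'I_q) (s : C) :  0 <= s ->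
  \sum_(x in pffun_on ord0 (mem S) predT | off_class S x c != set0)
    s ^+ #|off_class S x c| <= (1 + p%:R * s) ^+ #|S| - 1.
Proof.
move=> s0; rewrite lerBrDl.
have -> : (1 + p%:R * s) ^+ #|S| = 
   \prod_(v in S) \sum_(j < q) (if (q %| j + c)%N then 1 else s).
  rewrite -prodr_const; apply: eq_bigr => v _.
  have c0 : (q %| (q - c) %% q + c)%N.
    by rewrite /dvdn modnDml subnK ?modnn // ltnW.
  rewrite (bigD1 (Ordinal (ltn_pmod (q - c) (isT : 0 < q)%N))) //= c0; congr (_ + _).
  rewrite (eq_bigr (fun=> s)) => [|j jc]; last first.
    case: ifP => // jq; case/eqP: jc; apply: val_inj => /=.
    rewrite -[LHS](@modn_small _ q) // -[RHS]modn_mod.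
    by apply/eqP; rewrite -(eqn_modDr c) (eqP jq) (eqP c0).
  by rewrite sumr_const cardC1 card_ord mulr_natl.
rewrite (big_distr_big ord0) /= [leRHS](bigID (fun x : {ffun T -> 'I_q} =>
  off_class S x c == set0)) /=.
have wE (x : {ffun T -> 'I_q}) :
    \prod_(v in S) (if (q %| x v + c)%N then 1 else s) = s ^+ #|off_class S x c|.
  rewrite -prodr_const [LHS]big_mkcond [RHS]big_mkcond; apply: eq_bigr => v _ /=.
  by rewrite inE; case: (v \in S) => //=; case: ifP.
apply: lerD; last by apply: ler_sum => x _; rewrite wE.
have c0 : (q %| (q - c) %% q + c)%N.
  by rewrite /dvdn modnDml subnK ?modnn // ltnW.
pose x0 := [ffun v => if v \in S then Ordinal (ltn_pmod (q - c) (isT : 0 < q)%N)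
                     else ord0].
have off0 : off_class S x0 c = set0.
  by apply/setP => v; rewrite !inE ffunE; case: (v \in S) => //=; rewrite c0.
rewrite (bigD1 x0) /=; last first.
  rewrite off0 eqxx andbT; apply/pffun_onP; split => [|//].
  by apply/subsetP => v; rewrite !inE ffunE; case: (v \in S).
rewrite wE off0 cards0 expr0 lerDl sumr_ge0 // => x _.
by rewrite wE exprn_ge0.
Qed.

Lemma sum_minor_chars (S B : {set T}) (d : T -> nat) (t : nat) :
  (q * t < #|S :\: B|)%N ->
  `|q%:R ^+ #|S| * #|residue_sets S (touching S B) d|%:R -
    \sum_(x in main_chars S) fourier_term S (touching S B) d x| <=
  2 ^+ #|touching S B| * fourier_error p tau #|S| t.
Proof.
move=> tSB; have [t0 _] := andP tau01.
rewrite residue_sets_fourier; last by move=> e; rewrite inE => /and3P [].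
rewrite (bigID (mem (main_chars S))) /=.
have mE (x : {ffun T -> 'I_q}) : (x \in pffun_on ord0 (mem S) predT) && (x \in
  main_chars S)
    = (x \in main_chars S).
  apply: andb_idl => /imsetP [c _ ->]; apply/pffun_onP; split => [|//].
  by apply/subsetP => v; rewrite !inE ffunE; case: (v \in S).
under eq_bigl do rewrite mE.
rewrite addrAC subrr add0r; apply: le_trans (ler_norm_sum _ _ _) _.
apply: le_trans (ler_sum _ _) _.
  by move=> x /andP [xS xM]; apply: (norm_fourier_term_minor d tSB xS xM).
rewrite -mulr_sumr; apply: ler_wpM2l; first exact: exprn_ge0.
(* All terms are nonnegative, so the main characters may be put back; after exchanging the sums,
   each inner one is that of [sum_off_class]. *)
apply: (@le_trans _ _ (\sum_(c < q) \sum_(x in pffun_on ord0 (mem S) predT |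
  off_class S x c != set0)
    (tau ^+ t) ^+ #|off_class S x c|)).
  rewrite (exchange_big_dep (mem (pffun_on ord0 (mem S) predT))) /=;
    last by move=> c x _ /andP [].
  rewrite [leRHS](bigID (mem (main_chars S))) /= addrC.
  rewrite ler_wpDr ?sumr_ge0 // => [x _|].
    by apply: sumr_ge0 => c _; rewrite !exprn_ge0.
  apply: ler_sum => x /andP [xS _]; rewrite le_eqVlt; apply/orP; left.
  by apply/eqP; apply: eq_bigl => c; rewrite xS.
rewrite /fourier_error -/q -[X in X%:R]card_ord mulr_natl -sumr_const.
by apply: ler_sum => c _; apply: sum_off_class; apply: exprn_ge0.
Qed.

Lemma card_residue_sets_le (S B : {set T}) (d : T -> nat) (t : nat) :
  (q * t < #|S :\: B|)%N ->
  q%:R ^+ #|S| * #|residue_sets S (touching S B) d|%:R <=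
  2 ^+ #|touching S B| * ((self_opposite q)%:R + fourier_error p tau #|S| t).
Proof.
move=> tSB; have h := sum_minor_chars d tSB.
rewrite -[leLHS]ger0_norm; last by rewrite mulr_ge0 ?exprn_ge0.
have {h} := lerD h (lexx `|\sum_(x in main_chars S) fourier_term S (touching S B) d x|).
move=> /(le_trans (ler_normD _ _)); rewrite subrK => /le_trans; apply.
rewrite mulrDr addrC lerD2r; apply: le_trans (ler_norm_sum _ _ _) _.
apply: le_trans (_ : _ <= \sum_(x in main_chars S) 2 ^+ #|touching S B|) _.
  apply: ler_sum => x _; apply: le_trans (norm_fourier_term S B d x) _.
  have [t0 t1] := andP tau01.
  by rewrite ler_piMr ?exprn_ge0 // exprn_ile1.
by rewrite sumr_const -[leLHS]mulr_natr ler_wpM2l ?exprn_ge0 // ler_nat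
  card_main_chars_le.
Qed.

(* For even |S| every main character contributes the full 2^|touching|, with no
   sign. *)
Lemma card_residue_sets_ge (S B : {set T}) (d t : nat) :
  (q * t < #|S :\: B|)%N -> ~~ odd #|S| ->
  2 ^+ #|touching S B| * ((self_opposite q)%:R - fourier_error p tau #|S| t) <=
  q%:R ^+ #|S| * #|residue_sets S (touching S B) (fun=> d)|%:R.
Proof.
move=> tSB oS; have := sum_minor_chars (fun=> d) tSB.
have -> : \sum_(x in main_chars S) fourier_term S (touching S B) (fun=> d) x =
    2 ^+ #|touching S B| * (self_opposite q)%:R.
  rewrite -(@card_main_chars S); last first.
    by apply: contraTneq tSB => ->; rewrite set0D cards0.
  rewrite mulr_natr -sumr_const; apply: eq_bigr => x /imsetP [c]; rewrite inE => qc ->.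
  have q2 : (q %| 2 * c)%N by rewrite mul2n -addnn.
  rewrite /fourier_term (eq_bigr (fun=> w ^+ (c * d))) => [|v vS];
    last by rewrite ffunE vS.
  rewrite prodr_const -exprM -[#|S|]odd_double_half (negPf oS) add0n -mul2n.
  (* Evenness of [#|S|] brings the factor [2 * c], a multiple of [q], into the exponent. *)
  have /eqP -> : w ^+ (c * d * (2 * #|S|./2)) == 1.
    rewrite -(prim_order_dvd wq);
      have -> : (c * d * (2 * #|S|./2) = 2 * c * (d * #|S|./2))%N by ring.
    by rewrite dvdn_mulr.
  rewrite mul1r.
  rewrite -prodr_const; apply: eq_bigr => e; rewrite inE => /and3P [e2 eS _].
  rewrite (eq_bigr (fun=> c : nat)) => [|v ve]; last by rewrite ffunE (subsetP eS).
  rewrite sum_nat_const (eqP e2); move: q2; rewrite (prim_order_dvd wq) => /eqP ->.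
  by rewrite -mulr2n.
move=> /real_ler_distlCDr; rewrite mulrBr lerBlDr; apply.
by rewrite realB ?ger0_real ?mulr_ge0 ?exprn_ge0.
Qed.

End Fourier.

(** Only finitely many values [w ^+ m] occur, so the strict inequality of [norm_add1_lt2] is
    uniform, and [tau] can be taken rational. *)
Lemma prim_root_gap (p : nat) (w : algC) : p.+1.-primitive_root w ->
  exists M : nat, forall m, ~~ (p.+1 %| m)%N ->
    `|1 + w ^+ m| <= 2 * (1 - M.+1%:R^-1) ^+ 2.
Proof.
(* Since 2 (1 - 1/M)^2 >= 2 - 4/M, any M above 4 / (2 - |1 + w^m|) will do. At [m = 0] the
   denominator vanishes and the quotient is 0 by convention, which is harmless. *)
move=> wq; pose N (m : 'I_p.+1) := Num.bound (4 / (2 - `|1 + w ^+ m|)).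
exists (\max_m N m)%N => m qm.
rewrite -(prim_expr_mod wq m).
have {}qm : ~~ (p.+1 %| m %% p.+1)%N by rewrite /dvdn modn_mod.
have mp : (m %% p.+1 < p.+1)%N by rewrite ltn_pmod.
move: (m %% p.+1)%N mp qm => j jp qj.
have h := norm_add1_lt2 wq qj.
have d0 : 0 < 2 - `|1 + w ^+ j| by rewrite subr_gt0.
have b : 4 / (2 - `|1 + w ^+ j|) <= (\max_m N m).+1%:R.
  have /archi_boundP /ltW /le_trans : 0 <= 4 / (2 - `|1 + w ^+ j|).
    by rewrite divr_ge0 // ltW.
  by apply; rewrite ler_nat leqW //; exact: (bigop.leq_bigmax (F := N) (Ordinal jp)).
set M : algC := (\max_m N m).+1%:R in b *.
have M0 : 0 < M by rewrite ltr0n.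
have : 4 / M <= 2 - `|1 + w ^+ j|.
  by rewrite ler_pdivrMr // mulrC -ler_pdivrMr.
rewrite lerBrDr addrC -lerBrDr => /le_trans; apply.
rewrite -subr_ge0 [X in 0 <= X](_ : _ = 2 * (M^-1 ^+ 2)); last by ring.
by rewrite mulr_ge0 // exprn_ge0 // invr_ge0 ltW.
Qed.

(** The outcome of the Fourier analysis, stated without complex numbers. The lower bound asks for
    constant [d] and even [#|S|], so that no main character carries a phase. *)
Definition residue_approx (R : numFieldType) (p : nat) (s : R) (T : finType)
    (t : nat) : Prop :=
  forall S B : {set T}, (p.+1 * t < #|S :\: B|)%N ->
    (forall d, p.+1%:R ^+ #|S| * #|residue_sets p S (touching S B) d|%:R <=
       2 ^+ #|touching S B| *
       ((self_opposite p.+1)%:R + fourier_error p s #|S| t)) /\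
    (forall d, ~~ odd #|S| ->
       2 ^+ #|touching S B| *
       ((self_opposite p.+1)%:R - fourier_error p s #|S| t) <=
       p.+1%:R ^+ #|S| * #|residue_sets p S (touching S B) (fun=> d)|%:R).

Lemma card_residue_sets_approx (R : numFieldType) (p : nat) :
  exists2 s : R, 0 <= s < 1 & forall (T : finType) (t : nat), residue_approx p s T t.
Proof.
have [w wq] := C_prim_root_exists (isT : 0 < p.+1)%N.
have [M Mw] := prim_root_gap wq.
have s01 (F : numFieldType) : 0 <= (1 - M.+1%:R^-1 : F) < 1.
  rewrite subr_ge0 invf_le1 ?ltr0n // ler1n /= gtrBl invr_gt0 ltr0n //.
(* The witness is rational, so the bounds transfer from algC to R through rat. *)
exists (1 - M.+1%:R^-1) => [|T t S B tSB]; first exact: s01.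
have /andP [s0 s1] := s01 algC.
have s01' : 0 <= (1 - M.+1%:R^-1 : algC) <= 1 by rewrite s0 ltW.
set e := #|touching S B|; set k := #|S|; set g := self_opposite _.
have leE (F : numFieldType) (n : nat) :
    (p.+1%:R ^+ k * n%:R <= 2 ^+ e * (g%:R +
      fourier_error p (1 - M.+1%:R^-1 : F) k t)) =
    (p.+1%:R ^+ k * n%:R <= 2 ^+ e * (g%:R +
      fourier_error p (1 - M.+1%:R^-1 : rat) k t)).
  rewrite -[RHS](ler_rat F) /fourier_error.
  by rewrite !(rmorphM, rmorphB, rmorphXn, rmorphD, rmorph1, rmorph_nat, fmorphV).
have geE (F : numFieldType) (n : nat) :
    (2 ^+ e * (g%:R - fourier_error p (1 - M.+1%:R^-1 : F) k t) <=
      p.+1%:R ^+ k * n%:R) =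
    (2 ^+ e * (g%:R - fourier_error p (1 - M.+1%:R^-1 : rat) k t) <=
      p.+1%:R ^+ k * n%:R).
  rewrite -[RHS](ler_rat F) /fourier_error.
  by rewrite !(rmorphM, rmorphB, rmorphXn, rmorphD, rmorph1, rmorph_nat, fmorphV).
split=> [d|d oS].
  by rewrite leE -(leE algC) (card_residue_sets_le wq s01' Mw).
by rewrite geE -(geE algC) (card_residue_sets_ge wq s01' Mw).
Qed.

(** * Counting graphs *)

(** Exposes a random edge set in two stages: first the pairs off [H], then those in [H]. *)
Lemma sum_subsets_split (R : nmodType) (I : finType) (P H : {set I})
    (f : {set I} -> R) : H \subset P ->
  \sum_(E : {set I} | E \subset P) f E =
  \sum_(E : {set I} | E \subset P :\: H) \sum_(F : {set I} | F \subset H) f (E :|: F).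
Proof.
move=> HP.
rewrite (partition_big (fun E => E :\: H) (fun E => E \subset P :\: H)) /=; last first.
  by move=> E EP; apply: setSD.
apply: eq_bigr => E EPH.
have EH : E :&: H = set0.
  apply/setP => e; rewrite !inE; apply/andP => -[/(subsetP EPH)].
  by rewrite inE => /andP [/negPf ->].
rewrite (reindex_onto (fun F => E :|: F) (fun F => F :&: H)) /=; last first.
  by move=> F /andP [_ /eqP <-]; rewrite setUC setID.
apply: eq_bigl => F; rewrite setIUl EH set0U setDUl.
have -> : E :\: H = E by rewrite -[RHS](setID _ H) EH set0U.
apply/idP/idP => [/andP [_ /eqP <-]|FH]; first exact: subsetIr.
rewrite (setIidPl FH) eqxx andbT subUset (subset_trans EPH (subsetDl _ _)).
rewrite (subset_trans FH HP) /= (_ : F :\: H = set0) ?setU0 //.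
by apply/eqP; rewrite setD_eq0.
Qed.

Section Counting.
Variables (T : finType) (p r : nat).
Let q := p.+1.
Hypothesis rq : (r < q)%N.

Definition edge_degree (E : {set {set T}}) (S : {set T}) (v : T) : nat :=
  #|[set e in E | (e \subset S) && (v \in e)]|.

(* The congruence deg v = r mod q, as divisibility of q - r + deg v (r < q). *)
Definition edges_induce_mod (E : {set {set T}}) (S : {set T}) : bool :=
  [forall v in S, q %| q - r + edge_degree E S v]%N.

Lemma induced_degreeE (G : sgraph T) (S : {set T}) (v : T) : v \in S ->
  induced_degree G S v = edge_degree (edges G) S v.
Proof.
move=> vS; have GP e : e \in edges G -> #|e| = 2.
  by move=> eG; have := subsetP (valP G) e eG; rewrite inE => /eqP.
rewrite /induced_degree /edge_degree.
have loop y : adj G v y -> y != v.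
  by move=> /GP; rewrite cards2 eq_sym; case: eqP.
rewrite -(card_in_imset (f := fun y => [set v; y])); last first.
  move=> y y'; rewrite !inE => /andP [_ /loop yv] _; exact: set2_injr.
apply: eq_card => e; apply/imsetP/idP.
  move=> [y]; rewrite !inE => /andP [yS yG] ->.
  by rewrite -/(adj G v y) yG subUset !sub1set vS yS set21.
rewrite inE => /and3P [eG eS ve]; have := cardsD1 v e; rewrite ve (GP e eG) => -[].
move/esym/eqP/cards1P => [y ey].
have eE : e = [set v; y] by rewrite -(setD1K ve) ey.
exists y => //; rewrite inE /adj -eE eG andbT; apply: (subsetP eS).
by rewrite eE !inE eqxx orbT.
Qed.

Lemma induces_modE (G : sgraph T) (S : {set T}) :
  induces_mod G r q S = edges_induce_mod (edges G) S.
Proof.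
apply: eq_forallb_in => v vS; rewrite induced_degreeE //.
set d := edge_degree _ _ _.
rewrite -(eqn_modDl (q - r)) subnK ?modnn; last exact: ltnW.
by rewrite /dvdn; congr (_ == _).
Qed.

Lemma touching_sub (S B : {set T}) : touching S B \subset vertex_pairs T.
Proof. by apply/subsetP => e; rewrite !inE => /and3P []. Qed.

Lemma residue_setsE (S B : {set T}) (E : {set {set T}}) :
    E \subset vertex_pairs T :\: touching S B ->
  [set F : {set {set T}} | (F \subset touching S B) && edges_induce_mod (E :|: F) S] =
  residue_sets p S (touching S B) (fun v => q - r + edge_degree E S v)%N.
Proof.
move=> EP; apply/setP => F; rewrite !inE; case: (boolP (_ \subset _)) => //= FH.
apply: eq_forallb_in => v vS; congr (_ %| _)%N; rewrite -addnA; congr (_ + _)%N.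
rewrite /edge_degree -cardsUI.
have -> : [set e in E | (e \subset S) && (v \in e)] :&: [set e in F | v \in e] = set0.
  apply/setP => e; rewrite !inE; apply/negP => /andP [/andP [eE _] /andP [eF _]].
  by have := subsetP EP e eE; rewrite inE (subsetP FH _ eF).
rewrite cards0 addn0; apply: eq_card => e; rewrite !inE andb_orl; congr (_ || _).
case eF : (e \in F) => //=; have := subsetP FH e eF.
by rewrite inE => /and3P [_ -> _].
Qed.

(** With [B] empty all pairs inside [S] are still free, so the offset is the constant [q - r], as
    the lower bound in [residue_approx] requires. *)
Lemma edge_degree_disjoint (E : {set {set T}}) (S : {set T}) (v : T) :
  E \subset vertex_pairs T :\: touching S set0 -> edge_degree E S v = 0%N.
Proof.
move=> EP; apply/eqP; rewrite cards_eq0; apply/eqP/setP => e; rewrite !inE.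
apply/negP => /and3P [eE eS ve]; have := subsetP EP e eE.
rewrite !inE eS /= => /andP [] /[swap] ->; rewrite subset0 /= negbK.
by move=> /eqP e0; rewrite e0 inE in ve.
Qed.

(** The decoupling of the two events: a pair inside [S] but not inside [S :&: U] is not inside [U],
    so it affects no degree there. *)
Lemma edges_induce_modU (E F : {set {set T}}) (S U : {set T}) :
  F \subset touching S (S :&: U) ->
  edges_induce_mod (E :|: F) U = edges_induce_mod E U.
Proof.
move=> FH; apply: eq_forallb_in => v vU; congr (_ %| _ + _)%N.
apply: eq_card => e; rewrite !inE; case eF: (e \in F); last by rewrite orbF.
have := subsetP FH e eF; rewrite inE subsetI => /and3P [_ -> /= /negPf ->].
by rewrite !andbF.
Qed.

Variables (R : numFieldType) (s : R).

Definition mod_count (A : {set {set T}} -> bool) : R :=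
  \sum_(E : {set {set T}} | E \subset vertex_pairs T) (A E)%:R.

Lemma sum_subsets_const (H : {set {set T}}) (x : R) :
  \sum_(F : {set {set T}} | F \subset H) x = 2 ^+ #|H| * x.
Proof.
rewrite sumr_const (_ : #|_| = 2 ^ #|H|)%N ?mulr_natl -?natrX ?mulr_natl //.
by rewrite -card_powerset; apply: eq_card => F; rewrite powersetE.
Qed.

Variable t : nat.
Hypothesis approx : residue_approx p s T t.

Lemma sum_touching (S B : {set T}) (E : {set {set T}}) :
    E \subset vertex_pairs T :\: touching S B ->
  \sum_(F : {set {set T}} | F \subset touching S B) (edges_induce_mod (E :|: F) S)%:R =
  #|residue_sets p S (touching S B) (fun v => q - r + edge_degree E S v)%N|%:R :> R.
Proof.
move=> EP; rewrite -residue_setsE // -sum1_card natr_sum big_mkcond [RHS]big_mkcond.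
by apply: eq_bigr => F _; rewrite inE; case: (_ \subset _) => //=; case: ifP.
Qed.

Lemma mod_count_le (S : {set T}) : (q * t < #|S|)%N ->
  q%:R ^+ #|S| * mod_count (edges_induce_mod^~ S) <=
  2 ^+ #|vertex_pairs T| * ((self_opposite q)%:R + fourier_error p s #|S| t).
Proof.
rewrite -{1}[S]setD0 => tS; have [h _] := approx tS.
rewrite /mod_count (sum_subsets_split _ (touching_sub S set0)) mulr_sumr.
rewrite -(cardsID (touching S set0)) (setIidPr (touching_sub _ _)) addnC exprD
  -mulrA -sum_subsets_const.
by apply: ler_sum => E EP; rewrite sum_touching.
Qed.

Lemma mod_count_ge (S : {set T}) : (q * t < #|S|)%N -> ~~ odd #|S| ->
  2 ^+ #|vertex_pairs T| * ((self_opposite q)%:R - fourier_error p s #|S| t) <=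
  q%:R ^+ #|S| * mod_count (edges_induce_mod^~ S).
Proof.
rewrite -{1}[S]setD0 => tS oS; have [_ h] := approx tS.
rewrite /mod_count (sum_subsets_split _ (touching_sub S set0)) mulr_sumr.
rewrite -(cardsID (touching S set0)) (setIidPr (touching_sub _ _)) addnC exprD
  -mulrA -sum_subsets_const.
apply: ler_sum => E EP; rewrite sum_touching //; apply: le_trans (h (q - r)%N oS) _.
rewrite (_ : residue_sets _ _ _ _ = residue_sets p S (touching S set0)
  (fun v => q - r + edge_degree E S v)%N) //.
apply/setP => F; rewrite !inE; congr (_ && _); apply: eq_forallb_in => v _.
by rewrite (edge_degree_disjoint v EP) addn0.
Qed.

(** Once the pairs off [touching S (S :&: U)] are fixed, the goodness of [U] is a constant factor
    and that of [S] obeys a bound uniform in the fixed part; summing then leaves [mod_count_le] for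
    [U]. *)
Lemma mod_count2_le (S U : {set T}) : #|S| = #|U| -> (q * t < #|S :\: U|)%N ->
  0 <= (self_opposite q)%:R + fourier_error p s #|S| t ->
  (q%:R ^+ #|S|) ^+ 2 *
    mod_count (fun E => edges_induce_mod E S && edges_induce_mod E U) <=
  2 ^+ #|vertex_pairs T| * ((self_opposite q)%:R + fourier_error p s #|S| t) ^+ 2.
Proof.
move=> SU tSU e0.
have tU : (q * t < #|U|)%N.
  by rewrite -SU (leq_trans tSU) // subset_leq_card // subsetDl.
have DI : S :\: (S :&: U) = S :\: U by rewrite setDIr setDv set0U.
have tSI : (q * t < #|S :\: (S :&: U)|)%N by rewrite DI.
have [h _] := approx tSI.
rewrite !expr2 -mulrA [leRHS]mulrA.
have hU := mod_count_le tU; rewrite -SU in hU.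
apply: le_trans (ler_wpM2r e0 hU).
rewrite -[leRHS]mulrA; apply: ler_wpM2l; first exact: exprn_ge0.
rewrite /mod_count !(sum_subsets_split _ (touching_sub S (S :&: U))) mulr_sumr
  mulr_suml.
apply: ler_sum => E EP.
rewrite [X in _ <= X * _](eq_bigr (fun=> (edges_induce_mod E U)%:R)) => [|F FH];
  last first.
  by rewrite (edges_induce_modU _ FH).
rewrite (eq_bigr (fun F =>
  (edges_induce_mod (E :|: F) S)%:R * (edges_induce_mod E U)%:R)) => [|F FH];
    last first.
  by rewrite (edges_induce_modU _ FH) -natrM mulnb.
rewrite -mulr_suml sum_touching // sum_subsets_const mulrA [leRHS]mulrAC.
by apply: ler_wpM2r => //; exact: h.
Qed.

End Counting.

(** * The second moment *)

(** Chebyshev's inequality cleared of denominators: the right side is the sum of the squares (V X -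
    M)^2, and every zero of [X] contributes M^2 to it. *)
Lemma second_moment (R : realFieldType) (I : finType) (P : pred I) (X : I -> R) :
  (\sum_(i | P i) (X i == 0)%:R) * (\sum_(i | P i) X i) ^+ 2 <=
  (\sum_(i | P i) 1) * ((\sum_(i | P i) 1) * (\sum_(i | P i) X i ^+ 2) -
    (\sum_(i | P i) X i) ^+ 2).
Proof.
set V := \sum_(i | P i) 1; set M := \sum_(i | P i) X i;
  set Q := \sum_(i | P i) X i ^+ 2.
have -> : V * (V * Q - M ^+ 2) = \sum_(i | P i) (V * X i - M) ^+ 2.
  transitivity (\sum_(i | P i) (V ^+ 2 * X i ^+ 2 - 2 * V * M * X i + M ^+ 2 * 1)).
    by rewrite big_split sumrB -!mulr_sumr -/V -/M -/Q /=; ring.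
  by apply: eq_bigr => i _; ring.
rewrite mulr_suml; apply: ler_sum => i _; case: eqP => [->|_]; last first.
  by rewrite mul0r sqr_ge0.
by rewrite mulr0 sub0r sqrrN mul1r.
Qed.

(** With z = N/V and eta = D/m, the moments give z (g - e)^2 <= 4 g e + eta (g + e). As e <= g/2,
    the left side is at least z g^2 / 4 and the right side at most g (4 e + 2 eta); finally g >=
    1. *)
Lemma second_moment_algebra (R : realFieldType) (V N M Q m g e D : R) :
  0 < V -> 0 < m -> 1 <= g -> 0 <= e -> 2 * e <= 1 -> 0 <= D -> 0 <= N ->
  N * M ^+ 2 <= V * (V * Q - M ^+ 2) -> V * (m * (g - e)) <= M ->
  Q <= V * (m ^+ 2 * (g + e) ^+ 2 + m * D * (g + e)) ->
  N / V <= 16 * e + 8 * (D / m).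
Proof.
move=> V0 m0 g1 e0 e1 D0 N0 h M1 M2.
set z := N / V.
have z0 : 0 <= z by rewrite divr_ge0 // ltW.
set eta := D / m.
have eta0 : 0 <= eta by rewrite divr_ge0 // ltW.
have a0 : 0 <= m * (g - e) by rewrite mulr_ge0 ?ltW //; lra.
have b1 : (z + 1) * M ^+ 2 <= V * Q.
  have : N * M ^+ 2 = V * (z * M ^+ 2) by rewrite /z; field; rewrite gt_eqF.
  by move: h => /[swap] ->; rewrite ler_pM2l // mulrDl mul1r lerBrDr.
have b2 : (z + 1) * (V * (m * (g - e))) ^+ 2 <= (z + 1) * M ^+ 2.
  rewrite ler_wpM2l ?addr_ge0 // lerXn2r ?nnegrE //; first by rewrite mulr_ge0 // ltW.
  by rewrite (le_trans _ M1) // mulr_ge0 // ltW.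
have b3 := le_trans b2 (le_trans b1 (ler_wpM2l (ltW V0) M2)).
have b4 : (z + 1) * (g - e) ^+ 2 <= (g + e) ^+ 2 + eta * (g + e).
  rewrite -(ler_pM2l (_ : 0 < V ^+ 2 * m ^+ 2)) ?mulr_gt0 ?exprn_gt0 //.
  apply: le_trans (_ : _ <= (z + 1) * (V * (m * (g - e))) ^+ 2) _.
    by rewrite le_eqVlt; apply/orP; left; apply/eqP; ring.
  apply: le_trans b3 _; rewrite le_eqVlt; apply/orP; left; apply/eqP.
  by rewrite /eta; field; rewrite gt_eqF.
have b5 : z * (g - e) ^+ 2 <= 4 * g * e + eta * (g + e) by lra.
have b6 : z * (g / 2) ^+ 2 <= z * (g - e) ^+ 2.
  by apply: ler_wpM2l => //; rewrite lerXn2r ?nnegrE //; lra.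
have b7 : eta * (g + e) <= eta * (2 * g) by apply: ler_wpM2l => //; lra.
have b8 : z * g <= 16 * e + 8 * eta.
  rewrite -(ler_pM2r (_ : 0 < g / 4)); last by lra.
  by lra.
by apply: le_trans b8; rewrite ler_peMr.
Qed.

(** Every such set is the set of non-[None] values of a map from ['I_j] to [option T], where [None]
    pads sets with fewer than [j] elements. *)
Lemma card_sets_size_le (T : finType) (j : nat) :
  (#|[set D : {set T} | #|D| <= j]| <= #|T|.+1 ^ j)%N.
Proof.
pose f (u : {ffun 'I_j -> option T}) := [set x | Some x \in codom u].
have -> : (#|T|.+1 ^ j = #|{ffun 'I_j -> option T}|)%N.
  by rewrite card_ffun card_option card_ord.
apply: leq_trans (leq_imset_card f predT).
apply: subset_leq_card; apply/subsetP => D; rewrite inE => Dj.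
apply/imsetP; exists [ffun i : 'I_j => nth None (map Some (enum D)) i] => //.
apply/setP => x; rewrite inE; apply/idP/codomP => [xD|[i]].
  have xi : (index x (enum D) < #|D|)%N by rewrite cardE index_mem mem_enum.
  exists (Ordinal (leq_trans xi Dj)); rewrite ffunE /= (nth_map x) -?cardE //.
  by rewrite nth_index // mem_enum.
rewrite ffunE => /esym; case: (ltnP i #|D|) => iD.
  by rewrite (nth_map x) -?cardE // => -[<-]; rewrite -mem_enum mem_nth // -cardE.
by rewrite nth_default // size_map -cardE.
Qed.

Lemma card_near_sets (T : finType) (S : {set T}) (m : nat) :
  (#|[set U : {set T} | (#|U| == #|S|) && (#|S :\: U| <= m)]| <= #|T|.+1 ^ (2 * m))%N.
Proof.
apply: leq_trans (card_sets_size_le T (2 * m)).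
(* U is determined by its symmetric difference with S. *)
pose f (U : {set T}) := (S :\: U) :|: (U :\: S).
rewrite -(card_imset (f := f)); last first.
  move=> U U' /setP e; apply/setP => x; have := e x; rewrite !inE.
  by case: (x \in S); case: (x \in U); case: (x \in U').
apply: subset_leq_card; apply/subsetP => D /imsetP [U]; rewrite !inE.
move=> /andP [/eqP US Um] ->; rewrite (leq_trans (leq_card_setU _ _)) //.
have := cardsID U S; have := cardsID S U; rewrite setIC US; lia.
Qed.

Lemma self_opposite_gt0 (p : nat) : (0 < self_opposite p.+1)%N.
Proof. by apply/card_gt0P; exists ord0; rewrite inE. Qed.

Definition residue_mean (R : numFieldType) (q n k : nat) : R :=
  'C(n, k)%:R / q%:R ^+ k.

Section Moments.
Variables (R : realFieldType) (T : finType) (p r t : nat) (s : R).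
Let q := p.+1.
Let n := #|T|.
Let g : R := (self_opposite q)%:R.
Hypothesis approx : residue_approx p s T t.

Definition edge_prob (A : {set {set T}} -> bool) : R :=
  mod_count R A / 2 ^+ #|vertex_pairs T|.

Let mu (k : nat) : R := residue_mean R q n k.

Variable k : nat.
Hypothesis tk : (q * t < k)%N.
Let err : R := fourier_error p s k t.

Lemma sum_sets_const (x : R) :
  \sum_(S : {set T} | #|S| == k) x = 'C(n, k)%:R * x.
Proof.
rewrite sumr_const mulr_natl -/n -card_draws; congr (_ *+ _).
by apply: eq_card => S; rewrite !inE.
Qed.

(** The union bound over all [k]-sets. *)
Lemma edge_prob_exists_le :
  edge_prob (fun E => [exists S : {set T}, (#|S| == k) && edges_induce_mod p r E S])
    <= mu k * (g + err).
Proof.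
have P0 : (0 : R) < 2 ^+ #|vertex_pairs T| by rewrite exprn_gt0.
have Q0 : (0 : R) < q%:R ^+ k by rewrite exprn_gt0 // ltr0n.
rewrite /edge_prob ler_pdivrMr // /mu /residue_mean mulrAC -mulrA -mulrA.
apply: le_trans (_ : _ <=
  \sum_(S : {set T} | #|S| == k) mod_count R (edges_induce_mod p r ^~ S)) _.
  rewrite /mod_count exchange_big /=; apply: ler_sum => E _.
  case: existsP => [[S /andP [Sk gS]]|_]; last by rewrite sumr_ge0.
  by rewrite (bigD1 S) //= gS lerDl sumr_ge0.
apply: le_trans (_ : _ <=
  \sum_(S : {set T} | #|S| == k) (2 ^+ #|vertex_pairs T| * (g + err)) / q%:R ^+ k) _.
  apply: ler_sum => S /eqP Sk; rewrite ler_pdivlMr // mulrC /err -Sk.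
  by apply: mod_count_le => //; rewrite Sk.
rewrite sum_sets_const le_eqVlt; apply/orP; left; apply/eqP.
move: ('C(n, k)%:R : R) (2 ^+ #|vertex_pairs T| : R) (q%:R ^+ k : R) (g + err) =>
  a b c d.
by ring.
Qed.

Let num_good (E : {set {set T}}) : R :=
  \sum_(S : {set T} | #|S| == k) (edges_induce_mod p r E S)%:R.

Lemma num_good_eq0 E : (num_good E == 0) =
  ~~ [exists S : {set T}, (#|S| == k) && edges_induce_mod p r E S].
Proof.
rewrite psumr_eq0 // negb_exists; apply/allP/forallP => [h S|h S _].
  have := h S; rewrite mem_index_enum => /(_ isT); case: (#|S| == k) => //=.
  by case: (edges_induce_mod _ _ _ _); rewrite //= oner_eq0.
by apply/implyP => Sk; have := h S; rewrite Sk /= => /negPf ->.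
Qed.

Lemma sum_num_good : \sum_(E : {set {set T}} | E \subset vertex_pairs T) num_good E =
  \sum_(S : {set T} | #|S| == k) mod_count R (edges_induce_mod p r ^~ S).
Proof. by rewrite exchange_big. Qed.

Lemma sum_num_good_sqr :
  \sum_(E : {set {set T}} | E \subset vertex_pairs T) num_good E ^+ 2 =
  \sum_(S : {set T} | #|S| == k) \sum_(U : {set T} | #|U| == k)
    mod_count R (fun E => edges_induce_mod p r E S && edges_induce_mod p r E U).
Proof.
rewrite /mod_count; under [RHS]eq_bigr do rewrite exchange_big.
rewrite [RHS]exchange_big; apply: eq_bigr => E _ /=.
rewrite expr2 /num_good mulr_suml; apply: eq_bigr => S _; rewrite mulr_sumr.
by apply: eq_bigr => U _; rewrite -natrM mulnb.
Qed.

Hypotheses (even_k : ~~ odd k) (kn : (k <= n)%N).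
Hypotheses (err0 : 0 <= err) (err1 : 2 * err <= 1).

Let V : R := 2 ^+ #|vertex_pairs T|.
Let D : R := n.+1%:R ^+ (2 * (q * t)).

Let V0 : 0 < V. Proof. by rewrite exprn_gt0. Qed.
Let Q0 : (0 : R) < q%:R ^+ k. Proof. by rewrite exprn_gt0 // ltr0n. Qed.
Let g1 : 1 <= g. Proof. by rewrite ler1n self_opposite_gt0. Qed.
Let ge0 : 0 <= g + err. Proof. by rewrite addr_ge0 // (le_trans ler01). Qed.

Lemma num_good_mean_gt0 : 0 < mu k.
Proof. by rewrite divr_gt0 // ltr0n bin_gt0. Qed.

Lemma first_moment_ge : V * (mu k * (g - err)) <=
  \sum_(E : {set {set T}} | E \subset vertex_pairs T) num_good E.
Proof.
rewrite sum_num_good;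
  apply: le_trans (_ : _ <= \sum_(S : {set T} | #|S| == k) V * (g - err) / q%:R ^+ k) _.
  rewrite sum_sets_const le_eqVlt /mu /residue_mean; apply/orP; left; apply/eqP.
  move: ('C(n, k)%:R : R) (V) (q%:R ^+ k : R) (g - err) => a b c d.
  by ring.
apply: ler_sum => S /eqP Sk; rewrite ler_pdivrMr // mulrC -[leRHS]mulrC /err -Sk mulrC.
by apply: mod_count_ge => //; rewrite Sk.
Qed.

(** Pairs with [#|S :\: U| > q * t] are nearly independent by [mod_count2_le]. For the others the
    joint count is bounded by that of [S] alone, and each [S] has at most [D] such partners by
    [card_near_sets]. *)
Lemma second_moment_le :
  \sum_(E : {set {set T}} | E \subset vertex_pairs T) num_good E ^+ 2 <=
  V * (mu k ^+ 2 * (g + err) ^+ 2 + mu k * D * (g + err)).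
Proof.
rewrite sum_num_good_sqr.
apply: le_trans (_ : _ <= \sum_(S : {set T} | #|S| == k)
   (V * (mu k * (g + err) ^+ 2 + D * (g + err))) / q%:R ^+ k) _; last first.
  rewrite sum_sets_const le_eqVlt; apply/orP; left; apply/eqP.
  rewrite /mu /residue_mean.
  move: ('C(n, k)%:R : R) (V) (q%:R ^+ k : R) (g + err) (D) => a b c d e.
  by ring.
apply: ler_sum => S /eqP Sk.
rewrite (bigID (fun U => #|S :\: U| <= q * t)%N) /= addrC mulrDr mulrDl.
apply: lerD.
  apply: le_trans (_ : _ <= 
    \sum_(U : {set T} | #|U| == k) (V * (g + err) ^+ 2 / (q%:R ^+ k) ^+ 2)) _; last first.
    rewrite sum_sets_const le_eqVlt /mu /residue_mean; apply/orP; left; apply/eqP.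
    rewrite -exprVn; move: ('C(n, k)%:R : R) (V) ((q%:R ^+ k)^-1 : R) (g + err) =>
      a b c d.
    by ring.
  rewrite [leRHS](bigID (fun U => #|S :\: U| <= q * t)%N) /=
    addrC ler_wpDr ?sumr_ge0 //.
    by move=> U _; rewrite mulr_ge0 ?invr_ge0 ?mulr_ge0 ?exprn_ge0 // ltW.
  apply: ler_sum => U /andP [/eqP Uk]; rewrite -ltnNge => tSU.
  rewrite ler_pdivlMr ?exprn_gt0 // mulrC /err -Sk.
  by apply: mod_count2_le => //; rewrite Sk.
apply: le_trans (_ : _ <=
  \sum_(U in [set U : {set T} | (#|U| == #|S|) && (#|S :\: U| <= q * t)%N])
   V * (g + err) / q%:R ^+ k) _.
  rewrite [leRHS](eq_bigl (fun U : {set T} =>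
    (#|U| == k) && (#|S :\: U| <= q * t)%N)); last first.
    by move=> U; rewrite inE Sk.
  apply: ler_sum => U _;
    apply: (@le_trans _ _ (mod_count R (edges_induce_mod p r ^~ S))).
    by apply: ler_sum => E _; rewrite ler_nat; case: (edges_induce_mod _ _ _ S);
      case: (edges_induce_mod _ _ _ U).
  rewrite ler_pdivlMr // mulrC /err -Sk.
  by apply: mod_count_le => //; rewrite Sk.
rewrite sumr_const -[leLHS]mulr_natl.
apply: le_trans (_ : _ <= D * (V * (g + err) / q%:R ^+ k)) _.
  apply: ler_wpM2r; first by apply: divr_ge0; [apply: mulr_ge0 => //;
    exact: ltW | exact: ltW].
  by rewrite /D -natrX ler_nat; exact: card_near_sets.
rewrite le_eqVlt; apply/orP; left; apply/eqP.
move: (V) (q%:R ^+ k : R) (g + err) (D) => b c d e.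
by ring.
Qed.

Lemma edge_prob_none_le :
  edge_prob (fun E => ~~ [exists S : {set T}, (#|S| == k) && edges_induce_mod p r E S])
    <= 16 * err + 8 * (D / mu k).
Proof.
have m0 := num_good_mean_gt0; have M1 := first_moment_ge; have M2 := second_moment_le.
have := second_moment (fun E : {set {set T}} => E \subset vertex_pairs T) num_good.
set M := \sum_(_ | _) num_good _ in M1 *; set Q := \sum_(_ | _) _ ^+ 2 in M2 *.
rewrite sum_subsets_const mulr1 -/V.
set N := \sum_(_ | _) (_)%:R => h.
have -> : edge_prob (fun E =>
  ~~ [exists S : {set T}, (#|S| == k) && edges_induce_mod p r E S]) = N / V.
  by congr (_ / _); apply: eq_bigr => E _; rewrite num_good_eq0.
apply: (second_moment_algebra (M := M) (Q := Q) V0 m0 g1) => //; first exact: exprn_ge0.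
exact: sumr_ge0.
Qed.

End Moments.

(** * The function k(n, q) *)

(** Induction through C(n, j) = (n / j) C(n - 1, j - 1), where n / j >= q; the hypothesis passes to
    n - 1 and j - 1. *)
Lemma leq_expn_bin (q n j : nat) : (0 < q)%N -> (j * q <= n)%N -> (q ^ j <= 'C(n, j))%N.
Proof.
move=> q0; elim: j n => [|j IH] n jn; first by rewrite bin0.
have n0 : (0 < n)%N by nia.
have jn' : (j * q <= n.-1)%N by nia.
rewrite -(leq_pmul2l (ltn0Sn j)) -mul_bin_diag expnS mulnA.
by apply: leq_mul (IH _ jn').
Qed.

Section Kmod.
Variables (q n : nat).
Hypotheses (q2 : (2 <= q)%N) (qn : (q <= n)%N).

Let spec : (0 < q <= n)%N. Proof. by rewrite ltnW. Qed.

Lemma kmod_ge : (n %/ q <= kmod n q)%N.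
Proof.
have [_ _ h] := kmod_spec spec; apply: h.
rewrite ler_pdivlMr ?exprn_gt0 ?ltr0n 1?ltnW // mul1r -natrX ler_nat.
by rewrite leq_expn_bin ?leq_divM // ltnW.
Qed.

Lemma kmod_le : (kmod n q <= n)%N.
Proof.
have [_ + _] := kmod_spec spec; apply: contraLR; rewrite -ltnNge -ltNge => h.
by rewrite bin_small // mul0r.
Qed.

(** The conclusion says k >= n / (q + 1/2), the condition under which the means decay geometrically.
    It holds well below [kmod n q] because n / q exceeds n / (q + 1/2) by order n / q^2, which
    absorbs [d]. *)
Lemma kmod_step d k : (2 * q.+1 * (d + 3) * q <= n)%N -> (kmod n q <= k + d.+1)%N ->
  (2 * n <= (2 * q).+1 * k)%N.
Proof.
move=> dn kd; have : (n < q * (k + d.+2))%N.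
  have := ltn_ceil n (ltnW q2); have := kmod_ge; nia.
nia.
Qed.

End Kmod.

Section Means.
Variables (R : realFieldType) (q n : nat).
Hypothesis q2 : (2 <= q)%N.
Let theta : R := 1 - (2 * q%:R)^-1.
Let mean := residue_mean R q n.

Let q0 : (0 : R) < q%:R. Proof. by rewrite ltr0n ltnW. Qed.

Lemma theta_ge0 : 0 <= theta.
Proof.
rewrite subr_ge0 invf_le1 ?mulr_gt0 //.
by have := (ler_nat R 2 q); rewrite q2; lra.
Qed.

Lemma theta_lt1 : theta < 1.
Proof. by rewrite gtrBl invr_gt0 mulr_gt0. Qed.

Lemma residue_mean_ge0 k : 0 <= mean k.
Proof. by rewrite divr_ge0 // exprn_ge0. Qed.

Lemma residue_mean_ge1 k : (1 <= mean k) = (1 <= 'C(n, k)%:R * (q%:R : rat) ^- k).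
Proof.
rewrite ler_pdivlMr ?exprn_gt0 // ler_pdivlMr ?exprn_gt0 ?ltr0n 1?ltnW //.
by rewrite !mul1r -!natrX !ler_nat.
Qed.

(* The hypothesis on k makes the ratio (n - k) / (q (k + 1)) at most theta. *)
Lemma residue_meanS k : (2 * n <= (2 * q).+1 * k)%N -> mean k.+1 <= theta * mean k.
Proof.
move=> nk; rewrite /mean /residue_mean.
have [kn|kn] := ltnP n k.
  by rewrite !bin_small ?mul0r ?mulr0 // ltnW.
have bE : k.+1%:R * 'C(n, k.+1)%:R = (n%:R - k%:R) * 'C(n, k)%:R :> R.
  by rewrite -natrB // -!natrM mul_bin_left.
rewrite -(ler_pM2l (_ : 0 < k.+1%:R * q%:R ^+ k.+1)) ?mulr_gt0 ?ltr0Sn ?exprn_gt0 //.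
have -> : k.+1%:R * q%:R ^+ k.+1 * ('C(n, k.+1)%:R / q%:R ^+ k.+1) =
  (n%:R - k%:R) * 'C(n, k)%:R :> R.
  by rewrite -[RHS]bE; field; rewrite expf_neq0 // gt_eqF.
have -> : k.+1%:R * q%:R ^+ k.+1 * (theta * ('C(n, k)%:R / q%:R ^+ k)) =
    k.+1%:R * (q%:R - 2^-1) * 'C(n, k)%:R :> R.
  by rewrite /theta exprS; field; rewrite expf_neq0 gt_eqF.
apply: ler_wpM2r => //.
have : (2 * n)%:R <= ((2 * q).+1 * k)%:R :> R by rewrite ler_nat.
rewrite -[k.+1]addn1 -[(2 * q).+1]addn1 !(natrM, natrD).
have := ler_nat R 2 q; rewrite q2; lra.
Qed.

Lemma residue_mean_descent k j :
  (2 * n <= (2 * q).+1 * k)%N -> mean (k + j)%N <= theta ^+ j * mean k.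
Proof.
move=> nk; elim: j => [|j IH]; first by rewrite addn0 mul1r.
rewrite addnS exprS -mulrA; apply: le_trans (residue_meanS _) _.
  by rewrite (leq_trans nk) // leq_mul2l leq_addr orbT.
by rewrite ler_wpM2l ?theta_ge0.
Qed.

Hypothesis qn : (q <= n)%N.

Lemma kmodP : 1 <= mean (kmod n q).
Proof.
have /kmod_spec [_ h _] : (0 < q <= n)%N by rewrite ltnW.
by rewrite residue_mean_ge1.
Qed.

Lemma kmod_max k : (kmod n q < k)%N -> mean k < 1.
Proof.
have /kmod_spec [_ _ h] : (0 < q <= n)%N by rewrite ltnW.
by move=> hk; rewrite ltNge residue_mean_ge1; apply/negP => /h; rewrite leqNgt hk.
Qed.

(** The mean is already below 1 at [kmod n q + 1], and at least [d] further steps each gain a factor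
    [theta]. *)
Lemma residue_mean_above d k : (2 * q.+1 * (d + 3) * q <= n)%N ->
  (kmod n q + d < k)%N -> mean k <= theta ^+ d.
Proof.
move=> dn kd; have st := @kmod_step _ _ q2 qn d (kmod n q).+1 dn.
rewrite (_ : k = ((kmod n q).+1 + d) + (k - d - (kmod n q).+1))%N; last by lia.
rewrite -addnA; apply: le_trans (residue_mean_descent _ (st _)) _; first by lia.
apply: le_trans (_ : _ <= theta ^+ (d + (k - d - (kmod n q).+1))) _.
  by rewrite ler_piMr ?exprn_ge0 ?theta_ge0 // ltW // kmod_max.
by rewrite ler_wiXn2l ?theta_ge0 ?leq_addr // ltW ?theta_lt1.
Qed.

(** The same decay read backwards from [kmod n q], where the mean is at least 1. The slack of one in
    [k] leaves room for rounding to an even size. *)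
Lemma residue_mean_below d k : (2 * q.+1 * (d + 3) * q <= n)%N ->
  (k + d <= kmod n q <= k + d.+1)%N -> (mean k)^-1 <= theta ^+ d.
Proof.
move=> dn /andP [kd1 kd2]; have st := kmod_step q2 qn dn kd2.
have := kmodP; have -> : kmod n q = (k + (kmod n q - k))%N by lia.
move/le_trans/(_ (residue_mean_descent _ st)) => h.
have m0 : 0 < mean k.
  rewrite lt_def residue_mean_ge0 andbT; apply/negP => /eqP m0.
  by move: h; rewrite m0 mulr0 ler10.
rewrite -[leLHS]mul1r ler_pdivrMr //; apply: le_trans h _.
apply: ler_wpM2r; first exact: ltW.
by rewrite ler_wiXn2l ?theta_ge0 ?leq_subRL // ?ltW ?theta_lt1 //; lia.
Qed.

End Means.

(** * Elementary growth estimates *)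

Lemma expr1D_le (R : realFieldType) (y : R) (k : nat) : 0 <= y ->
  2 * k%:R * y <= 1 -> (1 + y) ^+ k <= 1 + 2 * k%:R * y.
Proof.
move=> y0; elim: k => [|k IH] ky; first by rewrite mulr0 mul0r addr0.
have {}ky : 2 * k%:R * y + 2 * y <= 1 by move: ky; rewrite -addn1 natrD; lra.
rewrite exprSr; apply: le_trans (ler_wpM2r _ (IH _)) _; [lra|lra|].
rewrite -[k.+1]addn1 natrD.
have : 2 * k%:R * y * y <= 1 * y by apply: ler_wpM2r => //; lra.
lra.
Qed.

(** With m the quotient of L by d + 1, c L^d <= c (2 (d + 1) m)^d <= m^(d + 1) <= 2^(m (d + 1)) <=
    2^L as soon as m exceeds c (2 (d + 1))^d. *)
Lemma leq_poly_expn (c d : nat) :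
  exists L0, forall L, (L0 <= L)%N -> (c * L ^ d <= 2 ^ L)%N.
Proof.
exists (d.+1 * (c * (2 * d.+1) ^ d).+1)%N => L LL.
set m := (L %/ d.+1)%N.
have cm : (c * (2 * d.+1) ^ d < m)%N.
  by rewrite /m leq_divRL // mulnC.
have Lm : (L <= 2 * d.+1 * m)%N.
  have := ltn_ceil L (ltn0Sn d); rewrite -/m; nia.
apply: leq_trans (_ : c * (2 * d.+1 * m) ^ d <= _)%N.
  rewrite leq_mul2l; apply/orP; right.
  by have [d0|d0] := posnP d; [rewrite d0 | rewrite leq_exp2r].
rewrite expnMn mulnA; apply: (@leq_trans (m ^ d.+1)%N).
  by rewrite expnS leq_mul2r ltnW ?orbT.
apply: leq_trans (_ : 2 ^ (m * d.+1) <= _)%N.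
  by rewrite expnM leq_exp2r // ltnW // ltn_expl.
by rewrite leq_exp2l // leq_divM.
Qed.

(** * The binomial law *)

From mathcomp Require Import all_classical all_reals all_analysis.

Import numFieldNormedType.Exports.

Lemma sum_sgraph (R : nmodType) (T : finType) (f : {set {set T}} -> R) :
  \sum_(G : sgraph T) f (edges G) =
  \sum_(E : {set {set T}} | E \subset vertex_pairs T) f E.
Proof.
rewrite [RHS](reindex_omap (val : sgraph T -> _) insub) /=; last first.
  by move=> E EP; rewrite insubT.
by apply: eq_bigl => G; rewrite valK eqxx andbT; apply/esym/(valP G).
Qed.

(** At p = 1/2 all graphs have equal weight, so probabilities are normalised counts. *)
Lemma gnp_prob_halfE (R : realType) (n : nat) (A : pred (sgraph 'I_n)) :
  gnp_prob (1 / 2 : R) A =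
    (\sum_(G : sgraph 'I_n) (A G)%:R) / 2 ^+ #|vertex_pairs 'I_n|.
Proof.
rewrite /gnp_prob big_mkcond mulr_suml; apply: eq_bigr => G _.
case: (A G); last by rewrite mul0r.
rewrite [RHS]mul1r /gnp_weight (eq_bigr (fun=> 2^-1)) => [|e _].
  by rewrite prodr_const exprVn.
by case: ifP => _; lra.
Qed.

Lemma gnp_prob_edges (R : realType) (n : nat) (A : {set {set 'I_n}} -> bool) :
  gnp_prob (1 / 2 : R) (fun G => A (edges G)) = edge_prob R A.
Proof. by rewrite gnp_prob_halfE (sum_sgraph (fun E => (A E)%:R)). Qed.

Lemma gnp_prob_le1 (R : realType) (n : nat) (A : pred (sgraph 'I_n)) :
  gnp_prob (1 / 2 : R) A <= 1.
Proof.
rewrite gnp_prob_halfE ler_pdivrMr ?exprn_gt0 // mul1r.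
apply: le_trans (_ : _ <= \sum_(G : sgraph 'I_n) 1) _.
  by apply: ler_sum => G _; case: (A G).
by rewrite (sum_sgraph (fun=> 1)) sum_subsets_const mulr1.
Qed.

Lemma gnp_prob_half_cover (R : realType) (n : nat) (I : finType) (P : pred I)
    (A B : pred (sgraph 'I_n)) (A_ : I -> pred (sgraph 'I_n)) :
  (forall G, [|| A G, B G | [exists i, P i && A_ i G]]) ->
  1 - gnp_prob (1 / 2 : R) A <= gnp_prob (1 / 2) B +
    \sum_(i | P i) gnp_prob (1 / 2) (A_ i).
Proof.
move=> cover; rewrite lerBlDl; under eq_bigr do rewrite gnp_prob_halfE.
rewrite !gnp_prob_halfE.
rewrite -mulr_suml -!mulrDl ler_pdivlMr ?exprn_gt0 // mul1r.
rewrite exchange_big -!big_split /= -[leLHS]mulr1.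
rewrite -sum_subsets_const -(sum_sgraph (fun=> 1)); apply: ler_sum => G _.
have := cover G; case: (A G) => [_|/=].
  by rewrite lerDl addr_ge0 ?sumr_ge0.
case: (B G) => [_|/existsP [i /andP [Pi AiG]]].
  by rewrite add0r lerDl sumr_ge0.
by rewrite !add0r (bigD1 i) //= AiG lerDl sumr_ge0.
Qed.

Lemma gnp_prob_mono (R : realType) (n : nat) (A B : pred (sgraph 'I_n)) :
  subpred A B -> gnp_prob (1 / 2 : R) A <= gnp_prob (1 / 2) B.
Proof.
move=> AB; rewrite !gnp_prob_halfE ler_wpM2r ?invr_ge0 ?exprn_ge0 //.
by apply: ler_sum => G _; rewrite ler_nat; case: (boolP (A G)) => // /AB ->.
Qed.

(** * An explicit failure bound for fixed n *)

Section FiniteBound.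
Variables (R : realType) (p r n : nat) (s : R).
Let q := p.+1.
Hypotheses (p0 : (0 < p)%N) (rq : (r < q)%N) (s01 : 0 <= s < 1).
Hypothesis approx : forall t, residue_approx p s 'I_n t.

Let L := trunc_log 2 n.
(** A power of two standing in for 1/n: it lies between 1/n and 2/n. *)
Let x : R := 2^-1 ^+ L.
Let theta : R := 1 - (2 * q%:R)^-1.
Hypotheses (L0 : (0 < L)%N) (n0 : (0 < n)%N).
Hypothesis Lq : (12 * q ^ 2 * L ^ 4 <= 2 ^ L)%N.
Hypothesis Ls : s ^+ L <= 4^-1.
Hypothesis Lth : theta ^+ L <= 2^-1 ^+ (4 * q + 2).

Let q2 : (2 <= q)%N. Proof. by []. Qed.

Let x0 : 0 < x. Proof. by rewrite exprn_gt0 // invr_gt0. Qed.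

Lemma succn_half_pow_le : n.+1%:R * x <= 2.
Proof.
rewrite /x exprVn ler_pdivrMr ?exprn_gt0 // -natrX -natrM ler_nat -expnS.
exact: trunc_log_ltn.
Qed.

(** This is (s^L)^L <= 4^-L; it is why the threshold [t] is taken to be [L ^ 2]. *)
Lemma decay_le : s ^+ (L ^ 2) <= x ^+ 2.
Proof.
have [s0 _] := andP s01.
rewrite -mulnn exprM /x [leRHS]exprAC.
apply: lerXn2r; rewrite ?nnegrE ?exprn_ge0 ?invr_ge0 //.
by apply: le_trans Ls _; rewrite exprVn lef_pV2 ?posrE //; lra.
Qed.

Lemma log_scale_small : 8 * q%:R * p%:R * x <= 1.
Proof.
have L1 : (1 <= L ^ 4)%N by rewrite expn_gt0 L0.
rewrite /x exprVn ler_pdivrMr ?exprn_gt0 // mul1r -natrX -!natrM ler_nat.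
by apply: leq_trans Lq; rewrite -mulnn /q; nia.
Qed.

(** Here k y <= p n x^2 up to rounding, so k y <= 2 p x, and (1 + y)^k - 1 <= 2 k y <= 4 p x; the
    remaining factor [q] comes from [fourier_error]. *)
Lemma fourier_error_le k : (k <= n)%N ->
  0 <= fourier_error p s k (L ^ 2) <= 4 * q%:R * p%:R * x.
Proof.
move=> kn; have [s0 _] := andP s01.
set y := p%:R * s ^+ (L ^ 2).
have y0 : 0 <= y by rewrite mulr_ge0 ?exprn_ge0.
have q8x := log_scale_small.
have ky : k%:R * y <= 2 * p%:R * x.
  rewrite /y mulrCA -[2 * _]mulrC -!mulrA; apply: ler_wpM2l => //.
  apply: le_trans (_ : _ <= n.+1%:R * x ^+ 2) _.
    by apply: ler_pM; rewrite ?exprn_ge0 ?decay_le // ler_nat leqW.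
  by rewrite expr2 mulrA ler_wpM2r ?succn_half_pow_le // ltW.
have q1 : 1 <= q%:R :> R by rewrite ler1n.
have px : 2 * p%:R * x <= 4^-1.
  have : p%:R * x * 1 <= p%:R * x * q%:R by rewrite ler_wpM2l // mulr_ge0 // ltW.
  lra.
rewrite /fourier_error -/y -/q; apply/andP; split.
  by rewrite mulr_ge0 // subr_ge0 exprn_ege1 // lerDl.
have : (1 + y) ^+ k - 1 <= 2 * (2 * p%:R * x).
  rewrite lerBlDl; apply: le_trans (expr1D_le y0 _) _; [lra|lra].
move=> /(ler_wpM2l (ltW (lt_le_trans ltr01 q1))) /le_trans; apply.
lra.
Qed.

Let d := (L ^ 4)%N.

Lemma theta_bounds : 0 <= theta <= 1.
Proof. by rewrite (theta_ge0 R q2) ltW // (theta_lt1 R q2). Qed.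

Lemma half_pow_le1 : x <= 1.
Proof. by apply: exprn_ile1; lra. Qed.

Lemma theta_d_le : theta ^+ d <= x ^+ (4 * q + 2).
Proof.
have [th0 th1] := andP theta_bounds.
have -> : d = (L * L ^ 3)%N by rewrite -expnS.
rewrite exprM /x [leRHS]exprAC.
have y0 : 0 <= 2^-1 ^+ (4 * q + 2) :> R by rewrite exprn_ge0 ?invr_ge0.
apply: (@le_trans _ _ ((2^-1 ^+ (4 * q + 2)) ^+ (L ^ 3))).
  by apply: lerXn2r; rewrite ?nnegrE ?exprn_ge0.
apply: ler_wiXn2l => //; first by apply: exprn_ile1; lra.
by rewrite -[X in (X <= _)%N]expn1 leq_pexp2l.
Qed.

(** As n + 1 <= 2^(2 L), the first factor is at most 2^(4 q L^3), while [theta ^+ d] is at most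
    2^(-(4 q + 2) L^3). The surplus 2 in the exponent leaves 2^(-2 L^3) <= 2^-L. *)
Lemma near_sets_negligible : n.+1%:R ^+ (2 * (q * L ^ 2)) * theta ^+ d <= x.
Proof.
have [th0 th1] := andP theta_bounds.
have y0 : 0 <= 2^-1 ^+ (4 * q + 2) :> R by rewrite exprn_ge0 ?invr_ge0.
have nL : n.+1%:R <= 2 ^+ (2 * L) :> R.
  rewrite -natrX ler_nat; apply: leq_trans (trunc_log_ltn n (isT : 1 < 2)%N) _.
  by rewrite leq_exp2l // mul2n -addnn -[X in (X <= _)%N]addn1 leq_add2l.
have -> : d = (L * L ^ 3)%N by rewrite -expnS.
apply: le_trans (_ : _ <=
  (2 ^+ (2 * L)) ^+ (2 * (q * L ^ 2)) * (2^-1 ^+ (4 * q + 2)) ^+ (L ^ 3)) _.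
  apply: ler_pM; rewrite ?exprn_ge0 // ?lerXn2r ?nnegrE ?exprn_ge0 //.
  by rewrite exprM lerXn2r ?nnegrE ?exprn_ge0.
rewrite -!exprM exprVn.
rewrite (_ : 2 * L * (2 * (q * L ^ 2)) = 4 * q * L ^ 3)%N;
  last by rewrite !expnS expn0; ring.
rewrite mulnDl exprD invfM mulrA divff ?mul1r ?expf_neq0 //.
rewrite /x exprVn lef_pV2 ?posrE ?exprn_gt0 // ler_weXn2l ?ler1n //.
rewrite (_ : 2 * L ^ 3 = L * (2 * L ^ 2))%N; last by rewrite !expnS expn0; ring.
by rewrite leq_pmulr // muln_gt0 expn_gt0 L0.
Qed.

Let k := kmod n q.
(* Rounded to an even number because of card_residue_sets_ge. *)
Let k' := ((k - d)./2).*2.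

(** All size conditions follow from n >= 2^L >= 12 q^2 L^4 and [kmod_ge]; rounding down to an even
    number costs at most one. *)
Lemma window_bounds : [/\ (q <= n)%N, (2 * q.+1 * (d + 3) * q <= n)%N,
  (q * L ^ 2 + d.+1 < k)%N & (k' + d <= k <= k' + d.+1)%N].
Proof.
have L1 : (1 <= L ^ 4)%N by rewrite expn_gt0 L0.
have L2 : (L ^ 2 <= L ^ 4)%N by rewrite leq_pexp2l.
have nL := leq_trans Lq (trunc_logP (isT : 1 < 2)%N n0).
have nL' : (12 * (q * q) * d <= n)%N by rewrite mulnn.
have qn : (q <= n)%N by rewrite /d in nL'; nia.
have kd : (q * L ^ 2 + d.+1 < k)%N.
  apply: leq_trans (kmod_ge q2 qn); rewrite leq_divRL ?ltnS //.
  rewrite /d in nL' *; nia.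
split=> //; first by rewrite /d in nL' *; nia.
by rewrite /k'; have := odd_double_half (k - d); case: odd; lia.
Qed.

Lemma self_opposite_le : (self_opposite q)%:R <= q%:R :> R.
Proof. by rewrite ler_nat -[X in (_ <= X)%N]card_ord; apply: max_card. Qed.

(** Failure means that no good set has size [k'] or that some good set has size above [k + d]. The
    first costs 16 err + 8 D / mu, at most (64 q p + 8) x; the second is a union bound over
    sizes. *)
Lemma gnp_prob_size_ge :
  1 - gnp_prob (1 / 2 : R) (fun G : sgraph 'I_n =>
      k' <= max_induced_mod G r q <= k + d)%N
    <= (64 * q%:R * p%:R + 8 + 2 * (q%:R + 1)) * x.
Proof.
have [qn dn kd k'P] := window_bounds; have [th0 th1] := andP theta_bounds.
pose A_ (K : nat) (E : {set {set 'I_n}}) :=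
  [exists S : {set 'I_n}, (#|S| == K) && edges_induce_mod p r E S].
have cover (G : sgraph 'I_n) : [|| (k' <= max_induced_mod G r q <= k + d)%N,
    ~~ A_ k' (edges G) | [exists K : 'I_n.+1, (k + d < K)%N && A_ K (edges G)]].
  case: existsP => [_|noK]; first by rewrite !orbT.
  case: (boolP (A_ k' (edges G))) => [/existsP [S /andP [/eqP Sk gS]]|_];
    last by rewrite orbT.
  rewrite /= orbF; apply/andP; split.
    rewrite -Sk; apply: (bigop.leq_bigmax_cond (F := fun S : {set 'I_n} => #|S|)).
    by rewrite /q induces_modE.
  apply/bigop.bigmax_leqP => U gU; rewrite leqNgt; apply/negP => Uk; apply: noK.
  have Un : (#|U| < n.+1)%N by rewrite ltnS -[X in (_ <= X)%N]card_ord max_card.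
  exists (Ordinal Un); rewrite /= Uk; apply/existsP; exists U.
  by rewrite eqxx -induces_modE.
have kn := kmod_le q2 qn.
have k'n : (k' <= #|'I_n|)%N by rewrite card_ord; lia.
have tk' : (q * L ^ 2 < k')%N by lia.
have k'n0 : (k' <= n)%N by lia.
have /andP [e0 e1] := fourier_error_le k'n0.
apply: le_trans (@gnp_prob_half_cover R n _ (fun K : 'I_n.+1 => k + d < K)%N _
  (fun G => ~~ A_ k' (edges G)) (fun K G => A_ K (edges G)) cover) _.
rewrite [leRHS](_ : _ = (64 * q%:R * p%:R + 8) * x + 2 * x * (q%:R + 1)); last by ring.
have := log_scale_small => qpx.
apply: lerD.
  rewrite (gnp_prob_edges R (fun E => ~~ A_ k' E)).
  have := @edge_prob_none_le R 'I_n p r (L ^ 2) s (@approx (L ^ 2)%N) k' tk' _ k'n e0 _.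
  rewrite odd_double /= => /(_ isT) none; apply: le_trans (none _) _; first by lra.
  have := residue_mean_below R q2 qn dn k'P; rewrite card_ord => below.
  have near : n.+1%:R ^+ (2 * (q * L ^ 2)) / residue_mean R q n k' <= x.
    by apply: le_trans near_sets_negligible; apply: ler_wpM2l => //; rewrite exprn_ge0.
  by lra.
under eq_bigr => K _ do rewrite (gnp_prob_edges R (A_ K)).
(* One factor [x] pays for the n + 1 possible sizes, the other survives in the bound. *)
have each (K : 'I_n.+1) : (k + d < K)%N -> edge_prob R (A_ K) <= x ^+ 2 * (q%:R + 1).
  move=> Kk; have tK : (q * L ^ 2 < K)%N.
    apply: leq_ltn_trans (leq_addr d.+1 _) (ltn_trans kd _).
    exact: leq_ltn_trans (leq_addr d k) Kk.
  have Kn : (K <= n)%N by rewrite -ltnS.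
  have /andP [E0 E1] := fourier_error_le Kn.
  apply: le_trans (@edge_prob_exists_le R 'I_n p r (L ^ 2) s (@approx (L ^ 2)%N) K
    tK) _.
  apply: ler_pM.
  - exact: residue_mean_ge0.
  - by rewrite addr_ge0.
  - rewrite card_ord; apply: le_trans (residue_mean_above R q2 qn dn Kk) _.
    apply: le_trans theta_d_le _; apply: ler_wiXn2l; [exact: ltW|exact: half_pow_le1|].
    by rewrite addn2.
  - by apply: lerD; [exact: self_opposite_le | lra].
apply: le_trans (_ : _ <= \sum_(K < n.+1) x ^+ 2 * (q%:R + 1)) _.
  rewrite big_mkcond; apply: ler_sum => K _; case: ifP => [/each //|_].
  by rewrite mulr_ge0 ?exprn_ge0 ?addr_ge0 // ltW.
rewrite sumr_const card_ord -[leLHS]mulr_natl mulrA expr2 mulrA.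
apply: ler_wpM2r; first by rewrite addr_ge0.
by apply: ler_wpM2r; [exact: ltW | exact: succn_half_pow_le].
Qed.

End FiniteBound.

(** * Passage to the limit *)

Local Open Scope classical_set_scope.

Lemma expr_eventually_le (R : realType) (a c : R) : 0 <= a < 1 -> 0 < c ->
  exists L0, forall L, (L0 <= L)%N -> a ^+ L <= c.
Proof.
move=> /andP [a0 a1] c0.
have : (fun L => a ^+ L) @ \oo --> (0 : R) by apply: cvg_expr; rewrite ger0_norm.
move=> /cvgrPdist_le /(_ _ c0) [L0 _ h]; exists L0 => L /h.
by rewrite sub0r normrN ger0_norm // exprn_ge0.
Qed.

Lemma trunc_log2_le_ln (R : realType) (n : nat) : (0 < n)%N ->
  (trunc_log 2 n)%:R * ln 2 <= ln n%:R :> R.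
Proof.
move=> n0; rewrite mulr_natl -lnXn // ler_ln ?posrE ?exprn_gt0 ?ltr0n //.
by rewrite -natrX ler_nat trunc_logP.
Qed.

(** The deviation is at most L^4 + 1 <= (2 L)^10, and L <= ln n / ln 2, whence the constant. *)
Lemma size_window_ln (R : realType) (n k f : nat) : let L := trunc_log 2 n in
  (0 < n)%N -> (0 < L)%N -> ((k - L ^ 4)./2.*2 <= f <= k + L ^ 4)%N ->
  `|f%:R - k%:R| <= (2 / ln 2) ^+ 10 * ln (n%:R : R) ^+ 10.
Proof.
move=> L n0 L0 /andP [kf fk].
have l2 : 0 < ln 2 :> R by apply: ln_gt0; lra.
have fkL : `|f%:R - k%:R : R| <= ((L ^ 4).+1)%:R.
  have h1 : (k <= f + (L ^ 4).+1)%N.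
    by have := odd_double_half (k - L ^ 4); move: kf; case: odd; lia.
  have h2 : (f <= k + (L ^ 4).+1)%N by lia.
  move: h1 h2; rewrite -!(ler_nat R) !natrD => h1 h2.
  by rewrite ler_norml; lra.
apply: le_trans fkL _; apply: le_trans (_ : _ <= (2 * L%:R) ^+ 10) _.
  rewrite -natrM -natrX ler_nat expnMn.
  have L4 : (0 < L ^ 4)%N by rewrite expn_gt0 L0.
  have : (L ^ 4 <= L ^ 10)%N by rewrite leq_pexp2l.
  by move: (L ^ 4)%N (L ^ 10)%N L4 => u v; lia.
have ln0 : 0 <= 2 / ln 2 * ln (n%:R : R).
  by rewrite mulr_ge0 ?ln_ge0 ?ler1n // divr_ge0 // ltW.
rewrite -exprMn; apply: lerXn2r; rewrite ?nnegrE //.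
by rewrite mulrAC ler_pdivlMr // -mulrA ler_pM2l // trunc_log2_le_ln.
Qed.

Theorem theorem1p1 (R : realType) (q r : nat) (hq : (2 <= q)%N) (hr : (r < q)%N) :
  exists2 C : R, 0 < C &
    (fun n : nat => gnp_prob (1 / 2 : R)
       (fun G : sgraph 'I_n =>
          `|(max_induced_mod G r q)%:R - (kmod n q)%:R| <= C * ln (n%:R : R) ^+ 10))
    @ \oo --> (1 : R).
Proof.
case: q hq hr => // p p0 rq; set q := p.+1 in rq *.
have l2 : 0 < ln 2 :> R by apply: ln_gt0; lra.
exists ((2 / ln 2) ^+ 10); first by rewrite exprn_gt0 // divr_gt0.
have [s s01 approx] := card_residue_sets_approx R p.
have th01 : 0 <= (1 - (2 * q%:R)^-1 : R) < 1 by rewrite theta_ge0 // theta_lt1.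
have [L1 hL1] := leq_poly_expn (12 * q ^ 2) 4.
have [L2 hL2] := expr_eventually_le s01 (ltac:(lra) : 0 < 4^-1 :> R).
have c0 : 0 < 2^-1 ^+ (4 * q + 2) :> R by rewrite exprn_gt0 // invr_gt0.
have [L3 hL3] := expr_eventually_le th01 c0.
set C0 : R := 64 * q%:R * p%:R + 8 + 2 * (q%:R + 1).
have C00 : 0 <= C0 by rewrite !addr_ge0 ?mulr_ge0 ?addr_ge0.
(* The failure bound is [C0] times 2^-L, and 2^-L <= 2 / (n + 1). *)
apply: (@squeeze_cvgr _ _ _ _ (fun n => 1 - 2 * C0 * harmonic n) (fun=> 1)).
- near=> n; rewrite gnp_prob_le1 andbT.
  set L := trunc_log 2 n.
  (* This puts [L] above all three thresholds at once and makes it positive. *)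
  have nL : (2 ^ (L1 + L2 + L3).+1 <= n)%N by near: n; exact: nbhs_infty_ge.
  have LL : (L1 + L2 + L3 < L)%N by apply: trunc_log_max.
  have n0 : (0 < n)%N by apply: leq_trans nL; rewrite expn_gt0.
  have L0 : (0 < L)%N by lia.
  have L1L : (L1 <= L)%N by lia.
  have L2L : (L2 <= L)%N by lia.
  have L3L : (L3 <= L)%N by lia.
  have key := @gnp_prob_size_ge R p r n s p0 rq s01 (approx 'I_n) L0 n0 (hL1 L L1L)
    (hL2 L L2L) (hL3 L L3L).
  have mono : gnp_prob (1 / 2 : R) (fun G : sgraph 'I_n =>
      (kmod n q - L ^ 4)./2.*2 <= max_induced_mod G r q <= kmod n q + L ^ 4)%N <=
    gnp_prob (1 / 2) (fun G : sgraph 'I_n =>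
      `|(max_induced_mod G r q)%:R - (kmod n q)%:R| <=
      (2 / ln 2) ^+ 10 * ln (n%:R : R) ^+ 10).
    by apply: gnp_prob_mono => G; apply: size_window_ln.
  apply: le_trans mono.
  rewrite lerBlDr -lerBlDl; apply: le_trans key _.
  rewrite -/C0 mulrC [2 * C0]mulrC -mulrA [leLHS]mulrC; apply: ler_wpM2l => //.
  by rewrite /harmonic ler_pdivlMr ?ltr0n // mulrC succn_half_pow_le.
- rewrite -[X in _ --> X](subr0 1) -[X in _ - X](mulr0 (2 * C0)).
  apply: cvgB; first exact: cvg_cst.
  by apply: cvgMr; exact: cvg_harmonic.
- exact: cvg_cst.
Unshelve. all: by end_near.
Qed.
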